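(* Let $\mathbb{F}_q$ be a finite field. For all $1\le k\le n$, the Grassmannian $G(k,n)$ yields an order domain with value semigroup $\Gamma_{k,n}$: the homogeneous coordinate ring over $\mathbb{F}_q$ of $G(k,n)\subset\mathbb{P}^{\binom{n}{k}-1}$ in its Plücker embedding (the coordinate ring of the affine cone over $G(k,n)$) has an order function with value semigroup $\Gamma_{k,n}$, ordered by a suitable monomial order.
   Context: $G(k,n)$ is the Grassmannian of $k$-dimensional subspaces of $n$-space, embedded in $\mathbb{P}^{\binom nk-1}$ by the $k\times k$ minors (Plücker coordinates) of a $k\times n$ matrix whose rows are a basis of the subspace. The semigroup $\Gamma_{k,n}$: Let $N=(t_{ij})$ be a generic $k\times n$ matrix of independent indeterminates. Let $\mathcal{B}_{k,n}$ be the $\binom nk\times kn$ matrix whose $\ell$th row has $1$'s in the positions corresponding to the $t_{ij}$ on the diagonal of the $\ell$th maximal minor of $N$ (for the minor on columns $j_1<\cdots<j_k$, the entries $t_{1j_1},t_{2j_2},\ldots,t_{kj_k}$) and zeroes in all other positions. $\Gamma_{k,n}\subset\mathbb{Z}_{\ge 0}^{kn}$ is the semigroup generated by the rows of $\mathcal{B}_{k,n}$ (equivalently the columns of its transpose), i.e. by the exponent vectors of the diagonal monomials $t_{1j_1}\cdots t_{kj_k}$. Order domain: Let $R$ be a commutative $\mathbb{F}_q$-algebra and let $(\Gamma,+,\succ)$ be a well-ordered commutative semigroup (the order is compatible with addition: $\alpha \prec \beta$ implies $\alpha+\gamma \prec \beta+\gamma$). An order function on $R$ is a surjective mapping $\rho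 : R \to \{-\infty\}\cup\Gamma$ satisfying: (i) $\rho(f) = -\infty \Leftrightarrow f=0$; (ii) $\rho(cf)=\rho(f)$ for all $f \in R$ and all $c\neq 0$ in $\mathbb{F}_q$; (iii) $\rho(f+g) \preceq \max_\succ\{\rho(f),\rho(g)\}$ for all $f,g\in R$; (iv) if $\rho(f)=\rho(g)\ne -\infty$, then there exists $c\neq 0$ in $\mathbb{F}_q$ such that $\rho(f-cg) \prec \rho(f)$; (v) $\rho(fg)=\rho(f)+\rho(g)$. $\Gamma$ is called the value semigroup, and $R$ together with $\rho$ is an order domain. *)

(* Defs.v *)
From HB Require Import structures.
From mathcomp Require Import all_boot all_order all_algebra all_field.
From mathcomp Require Import boolp.
From mathcomp Require Import mpoly.

Set Implicit Arguments.
Unset Strict Implicit.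
Unset Printing Implicit Defensive.

Import GRing.Theory.
Local Open Scope ring_scope.
Local Open Scope quotient_scope.

Record wo_semigroup (G : eqType) (add : G -> G -> G) (lt : rel G) : Prop :=
  WoSemigroup {
    wo_addA : associative add;
    wo_addC : commutative add;
    wo_irr : irreflexive lt;
    wo_trans : transitive lt;
    wo_total : forall a b, [|| lt a b, a == b | lt b a];
    wo_addr : forall a b c, lt a b -> lt (add a c) (add b c);
    wo_wf : well_founded lt
  }.

Section MinusInfinity.
Variables (G : eqType) (add : G -> G -> G) (lt : rel G).

(* In option G, None stands for -oo. *)
Definition ninf_lt (x y : option G) : bool :=
  match x, y with
  | None, Some _ => true
  | Some a, Some b => lt a b
  | _, None => false
  end.

Definition ninf_le (x y : option G) : bool := (x == y) || ninf_lt x y.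

Definition ninf_max (x y : option G) : option G := if ninf_lt x y then y else x.

Definition ninf_add (x y : option G) : option G :=
  match x, y with
  | Some a, Some b => Some (add a b)
  | _, _ => None
  end.

End MinusInfinity.

Record order_function (F : finFieldType) (R : comAlgType F)
    (G : eqType) (add : G -> G -> G) (lt : rel G) (rho : R -> option G) : Prop :=
  OrderFunction {
    of_surj : forall x : option G, exists f : R, rho f = x;
    of_ninf : forall f : R, rho f = None <-> f = 0;
    of_scale : forall (c : F) (f : R), c != 0 -> rho (c *: f) = rho f;
    of_add : forall f g : R,
      ninf_le lt (rho (f + g)) (ninf_max lt (rho f) (rho g));
    of_sub : forall f g : R, rho f = rho g -> rho f <> None ->
      exists2 c : F, c != 0 & ninf_lt lt (rho (f - c *: g)) (rho f);
    of_mul : forall f g : R, rho (f * g) = ninf_add add (rho f) (rho g)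
  }.

Definition order_domain (F : finFieldType) (R : comAlgType F)
    (G : eqType) (add : G -> G -> G) (lt : rel G) (rho : R -> option G) : Prop :=
  wo_semigroup add lt /\ order_function add lt rho.

Definition monomial_order (m : nat) (lt : rel 'rV[nat]_m) : Prop :=
  wo_semigroup (fun a b : 'rV[nat]_m => a + b) lt.

Section Plucker.
Variables k n : nat.

(* The l-th sequence of columns j_1 < ... < j_k. *)
Definition minor_cols (l : 'I_'C(n, k)) : k.-tuple 'I_n :=
  enum_val (cast_ord (esym (card_ltn_sorted_tuples k n)) l).

Definition plucker (K : fieldType) (M : 'M[K]_(k, n)) : 'rV[K]_'C(n, k) :=
  \row_l \det (colsub (tnth (minor_cols l)) M).

Definition affine_cone (K : fieldType) (v : 'rV[K]_'C(n, k)) : Prop :=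
  v = 0 \/
  exists U : {vspace 'rV[K]_n}, exists b : k.-tuple 'rV[K]_n, exists c : K,
    [/\ \dim U = k, basis_of U b, c != 0 &
        v = c *: plucker (\matrix_(i < k) tnth b i)].

End Plucker.

Section CoordinateRing.
Variables (F : finFieldType) (k n : nat).

Definition alg_closure : countClosedFieldType :=
  projT1 (countable_algebraic_closure F).

Definition to_closure : {rmorphism F -> alg_closure} :=
  sval (projT2 (countable_algebraic_closure F)).

(* The points of G(k,n) are taken over the algebraic closure: a finite field
   has too few points for their vanishing ideal to define the Grassmannian. *)
Definition plucker_ideal : {pred {mpoly F['C(n, k)]}} :=
  fun p => `[< forall v : 'rV[alg_closure]_'C(n, k), affine_cone v ->
                 (map_mpoly to_closure p).@[v 0] = 0 >].

Lemma plucker_idealP p :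
  reflect (forall v, @affine_cone k n alg_closure v ->
             (map_mpoly to_closure p).@[v 0] = 0) (p \in plucker_ideal).
Proof. exact: asboolP. Qed.

Lemma plucker_idealr_closed : idealr_closed plucker_ideal.
Proof.
split.
- by apply/plucker_idealP => v _; rewrite raddf0 meval0.
- apply/negP => /plucker_idealP /(_ 0 (or_introl erefl)).
  by rewrite rmorph1 meval1 => /eqP; rewrite oner_eq0.
- move=> a p q /plucker_idealP hp /plucker_idealP hq.
  apply/plucker_idealP => v hv.
  by rewrite rmorphD rmorphM mevalD mevalM hp // hq // mulr0 addr0.
Qed.

HB.instance Definition _ := isIdealr.Build _ plucker_ideal plucker_idealr_closed.

Definition coord_ring := {ideal_quot plucker_ideal}.
HB.instance Definition _ := GRing.ComNzRing.on coord_ring.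

Definition coord_scale (c : F) (f : coord_ring) : coord_ring :=
  \pi_{ideal_quot plucker_ideal} c%:MP * f.

Fact coord_scaleA a b f : coord_scale a (coord_scale b f) = coord_scale (a * b) f.
Proof. by rewrite /coord_scale mulrA -rmorphM -mpolyCM. Qed.
Fact coord_scale1 : left_id 1 coord_scale.
Proof. by move=> f; rewrite /coord_scale rmorph1 mul1r. Qed.
Fact coord_scaleDr : right_distributive coord_scale +%R.
Proof. by move=> c f g; rewrite /coord_scale mulrDr. Qed.
Fact coord_scaleDl f : {morph coord_scale^~ f : a b / a + b}.
Proof. by move=> a b; rewrite /coord_scale mpolyCD rmorphD mulrDl. Qed.

HB.instance Definition _ := GRing.Zmodule_isLmodule.Build F coord_ring
  coord_scaleA coord_scale1 coord_scaleDr coord_scaleDl.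

Fact coord_scaleAl (a : F) (f g : coord_ring) : a *: (f * g) = a *: f * g.
Proof. exact: mulrA. Qed.
HB.instance Definition _ := GRing.Lmodule_isLalgebra.Build F coord_ring coord_scaleAl.
HB.instance Definition _ := GRing.Lalgebra_isComAlgebra.Build F coord_ring.

End CoordinateRing.

Arguments plucker_ideal F k n : clear implicits.

Section Gamma.
Variables k n : nat.

(* The (i, j) entry of a k x n matrix has position mxvec_index i j. *)
Definition diag_mx_exponents : 'M[nat]_('C(n, k), k * n) :=
  \matrix_(l < 'C(n, k))
    mxvec (\matrix_(i < k, j < n) nat_of_bool (j == tnth (minor_cols l) i)).

(* The semigroup generated by the rows contains the empty sum 0: rho 1 has to be
   neutral in the value semigroup. *)
Definition in_Gamma : {pred 'rV[nat]_(k * n)} :=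
  fun v => `[< exists a : 'rV[nat]_'C(n, k), v = a *m diag_mx_exponents >].

Fact in_Gamma_addr_closed : addr_closed in_Gamma.
Proof.
split; first by apply/asboolP; exists 0; rewrite mul0mx.
move=> u v /asboolP [a ->] /asboolP [b ->].
by apply/asboolP; exists (a + b); rewrite mulmxDl.
Qed.
HB.instance Definition _ := GRing.isAddClosed.Build _ in_Gamma in_Gamma_addr_closed.

Record Gamma := MkGamma { Gamma_val :> 'rV[nat]_(k * n); _ : Gamma_val \in in_Gamma }.
HB.instance Definition _ := [isSub for Gamma_val].
HB.instance Definition _ := [Choice of Gamma by <:].
HB.instance Definition _ :=
  GRing.SubChoice_isSubNmodule.Build _ _ Gamma in_Gamma_addr_closed.

End Gamma.

Arguments in_Gamma k n : clear implicits.

(* Main.v *)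
(* The coordinate ring is the subalgebra B of F[t_ij] generated by the maximal
   minors: every point of the cone is the Plücker vector of a matrix, and a
   polynomial vanishing at all matrices over an infinite field is zero. The value
   of f is its leading exponent a for the graded reverse lexicographic order in
   which t_1n, t_2n, ..., t_kn, t_1(n-1), ... increase; all axioms are immediate
   once a is known to lie in Gamma.

   No straightening law is needed for this. After passing to a homogeneous
   component, the rows of a have equal sums, so a lies in Gamma as soon as
   a_(i+1,1) + ... + a_(i+1,m) <= a_(i,1) + ... + a_(i,m-1) for all i and m: the
   leftmost entries of the rows then form a diagonal monomial that can be peeled
   off. Elements of B are unchanged when row i is subtracted from row i+1, and
   this survives dividing by the largest power of the smallest variable and then
   setting that variable to 0, which is how a is read off one variable at a time;
   a degree comparison along a line of matrices then gives the inequality. *)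

From Stdlib Require Import Wellfounded.
Require Import Defs.
From HB Require Import structures.
From mathcomp Require Import all_boot all_order all_algebra all_field.
From mathcomp Require Import perm boolp.
From mathcomp Require Import mpoly zify.

Set Implicit Arguments.
Unset Strict Implicit.
Unset Printing Implicit Defensive.

Import Order.TTheory GRing.Theory.
Local Open Scope ring_scope.

(** * Graded reverse lexicographic order *)

Section RevLex.
Variables (N : nat) (pos : 'I_N -> nat).
Hypotheses (pos_inj : injective pos) (pos_lt : forall q, (pos q < N)%N).

(* The first [N] coordinates are the sums of [a] over the positions after [c]; the
   last one makes the degree equal to [N * mdeg a]. The degree-lexicographic order
   on keys is thus the graded reverse lexicographic order on exponents. *)
Definition rlkey (a : 'X_{1..N}) : 'X_{1..N.+1} :=
  [multinom (if (c < N)%N then \sum_(q | (c < pos q)%N) a q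
             else \sum_q (N - pos q) * a q)%N | c < N.+1].

Lemma rlkey_widen a (c : nat) (hc : (c < N.+1)%N) : (c < N)%N ->
  rlkey a (Ordinal hc) = (\sum_(q | (c < pos q)%N) a q)%N.
Proof. by move=> cN; rewrite mnmE /= cN. Qed.

Lemma rlkeyD a b : rlkey (a + b)%MM = (rlkey a + rlkey b)%MM.
Proof.
apply/mnmP => c; rewrite mnmDE !mnmE; case: ifP => _.
  by rewrite -big_split /=; apply: eq_bigr => q _; rewrite mnmDE.
by rewrite -big_split /=; apply: eq_bigr => q _; rewrite mnmDE mulnDr.
Qed.

Lemma rlkey0 : rlkey 0%MM = 0%MM.
Proof.
apply/mnmP => c; rewrite mnm0E mnmE; case: ifP => _; rewrite big1 // => q _;
by rewrite mnm0E ?muln0.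
Qed.

(** The exponent [a q] is counted in the [pos q] coordinates [c < pos q], and the weight [N - pos q]
    of the last coordinate completes this to [N]. *)
Lemma mdeg_rlkey a : mdeg (rlkey a) = (N * mdeg a)%N.
Proof.
rewrite !mdegE big_ord_recr /= mnmE /= ltnn.
have E c : rlkey a (widen_ord (leqnSn N) c) = (\sum_q (c < pos q) * a q)%N.
  rewrite mnmE /= ltn_ord big_mkcond /=; apply: eq_bigr => q _.
  by case: ltnP => _; rewrite ?mul1n.
under eq_bigr => c _ do rewrite E.
rewrite exchange_big /= -big_split /= big_distrr /=; apply: eq_bigr => q _.
rewrite -big_distrl /= -mulnDl; congr (_ * _)%N.
have -> : (\sum_(c < N) (c < pos q) = pos q)%N.
  transitivity (\sum_(c < N | (c < pos q)%N) 1)%N; first by rewrite [RHS]big_mkcond.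
  by rewrite (big_ord_narrow (ltnW (pos_lt q))) sum1_card card_ord.
by rewrite subnKC // ltnW.
Qed.

(** In equal degree, the sum over the positions after [c] is complementary to the sum up to [c].
    Before [pos v] these sums agree, and at [pos v] the larger exponent of [a] leaves the smaller
    remainder. *)
Lemma rlkey_lt a b (v : 'I_N) : mdeg a = mdeg b ->
  (forall q, (pos q < pos v)%N -> a q = b q) -> (b v < a v)%N ->
  (rlkey a < rlkey b)%O.
Proof.
move=> dab hlt hv.
have split_sum (x : 'X_{1..N}) c : mdeg x =
    (\sum_(q | (c < pos q)%N) x q + \sum_(q | (pos q <= c)%N) x q)%N.
  rewrite mdegE (bigID (fun q => (c < pos q)%N)) /=; congr (_ + _)%N.
  by apply: eq_bigl => q; rewrite -leqNgt.
apply/ltmcP; first by rewrite !mdeg_rlkey dab.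
have vN := pos_lt v; exists (Ordinal (ltnW vN : (pos v < N.+1)%N)).
  move=> [c cN] /= hc; rewrite !rlkey_widen ?(ltn_trans hc) //.
  have:= dab; rewrite (split_sum a c) (split_sum b c) => e.
  apply/eqP; rewrite -(eqn_add2r (\sum_(q | (pos q <= c)%N) a q)) e; apply/eqP.
  by congr (_ + _)%N; apply: eq_bigr => q hq; rewrite hlt // (leq_ltn_trans hq).
rewrite !rlkey_widen //.
have:= dab; rewrite (split_sum a (pos v)) (split_sum b (pos v)) => e.
rewrite -(ltn_add2r (\sum_(q | (pos q <= pos v)%N) a q)) e ltn_add2l.
rewrite (bigD1 v) //= [X in (_ < X)%N](bigD1 v) //=.
rewrite [X in (_ + X < _)%N](_ : _ =
  \sum_(q | (pos q <= pos v)%N && (q != v)) a q)%N ?ltn_add2r //.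
apply: eq_bigr => q /andP[h1 h2]; rewrite hlt // ltn_neqAle h1 andbT.
by apply: contra h2 => /eqP /pos_inj ->.
Qed.

Lemma rlkey_inj : injective rlkey.
Proof.
move=> a b e.
have dab : mdeg a = mdeg b.
  have:= congr1 mdeg e; rewrite !mdeg_rlkey => /eqP.
  (* For [N = 0] the degree of the key gives nothing, but both exponents are empty. *)
  rewrite eqn_mul2l => /orP[/eqP N0|/eqP //].
  have noq (q : 'I_N) : False by have := ltn_ord q; rewrite [X in (_ < X)%N]N0.
  by rewrite !mdegE !big1 // => q; case: (noq q).
apply/eqP; apply/negPn/negP => nab.
have [v0 hv0] : exists v, a v != b v.
  apply/existsP; rewrite -negb_forall; apply: contra nab => /forallP h.
  by apply/eqP/mnmP => q; apply/eqP.
pose v := [arg min_(v < v0 | a v != b v) pos v].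
have [hv hmin] : a v != b v /\ forall q, (pos q < pos v)%N -> a q = b q.
  rewrite /v; case: arg_minnP => //= w hw hm; split => // q; rewrite ltnNge => h.
  by apply/eqP/negPn/negP => /hm h'; rewrite h' in h.
have [h|h] : (a v < b v)%N \/ (b v < a v)%N.
  by case: ltngtP hv; [left|right|].
  have:= @rlkey_lt b a v (esym dab) (fun q hq => esym (hmin q hq)) h.
  by rewrite e ltxx.
by have:= @rlkey_lt a b v dab hmin h; rewrite e ltxx.
Qed.

Variable F : fieldType.

(** A monomial substitution, injective because [rlkey] is. Through it [mlead], which belongs to the
    degree-lexicographic order, computes leading exponents for the graded reverse lexicographic
    one. *)
Definition rlmap (p : {mpoly F[N]}) : {mpoly F[N.+1]} :=
  mmap (@mpolyC N.+1 F) (fun q => 'X_[rlkey U_(q)]) p.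

HB.instance Definition _ := GRing.RMorphism.copy rlmap
  (mmap (@mpolyC N.+1 F) (fun q => 'X_[rlkey U_(q)])).

Lemma rlmapX a : rlmap 'X_[a] = 'X_[rlkey a].
Proof.
rewrite /rlmap mmapX /mmap1; under eq_bigr => q _ do rewrite mpolyXn.
rewrite mprodXE; congr 'X_[_]; rewrite {2}(multinomUE_id a).
rewrite (big_morph _ rlkeyD rlkey0); apply: eq_bigr => q _.
elim: (a q) => [|m IH]; first by rewrite !mulm0n rlkey0.
by rewrite !mulmS IH rlkeyD.
Qed.

Lemma rlmapE p : rlmap p = \sum_(b <- msupp p) p@_b *: 'X_[rlkey b].
Proof.
by apply: eq_bigr => b _; rewrite -rlmapX /rlmap mmapX mul_mpolyC.
Qed.

Lemma mcoeff_rlmap p a : (rlmap p)@_(rlkey a) = p@_a.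
Proof.
rewrite rlmapE raddf_sum /=.
under eq_bigr => b _ do rewrite mcoeffZ mcoeffX (inj_eq rlkey_inj).
have [ha|ha] := boolP (a \in msupp p).
  rewrite (bigD1_seq a) ?msupp_uniq //= eqxx mulr1 big1 ?addr0 // => b /negbTE ->.
  by rewrite mulr0.
rewrite (memN_msupp_eq0 ha) big_seq_cond big1 // => b /andP[hb _].
by case: eqP hb ha => [->|_]; rewrite ?mulr0 // => ->.
Qed.

Lemma msupp_rlmap p b : b \in msupp (rlmap p) ->
  exists2 a, a \in msupp p & b = rlkey a.
Proof.
rewrite rlmapE => /msupp_sum_le /flattenP [s].
rewrite filter_predT => /mapP [a ha ->] /msuppZ_le.
by rewrite msuppX inE => /eqP ->; exists a.
Qed.

Lemma rlmap_eq0 p : (rlmap p == 0) = (p == 0).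
Proof.
apply/eqP/eqP => [e|->]; last by rewrite rmorph0.
by apply/mpolyP => a; rewrite -mcoeff_rlmap e !mcoeff0.
Qed.

Lemma rlmap_lead p : p != 0 -> exists2 a, a \in msupp p & mlead (rlmap p) = rlkey a.
Proof. by rewrite -rlmap_eq0 => /mlead_supp /msupp_rlmap. Qed.

(** This form of maximality, one variable at a time, is the one that [stage] carries through the
    elimination of variables. *)
Lemma rlmap_lead_min p a b v : mlead (rlmap p) = rlkey a -> b \in msupp p ->
  mdeg b = mdeg a -> (forall q, (pos q < pos v)%N -> b q = a q) -> (a v <= b v)%N.
Proof.
move=> la hb dab hlt; rewrite leqNgt; apply/negP => hv.
have h : (rlkey b <= rlkey a)%O.
  by rewrite -la msupp_le_mlead // mcoeff_msupp mcoeff_rlmap -mcoeff_msupp.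
by have:= @rlkey_lt a b v (esym dab) (fun q hq => esym (hlt q hq)) hv;
  rewrite ltNge h.
Qed.

End RevLex.


(** * Row operations and leading exponents *)

Section Slice.
Variables (N : nat) (F : fieldType).
Implicit Types (g : {mpoly F[N]}) (v : 'I_N) (b : 'X_{1..N}) (e : nat).

(** The coefficient of the [e]-th power of the variable [v]. When [e] bounds the exponents of [v]
    from below, it is [g] divided by that power and restricted to [v = 0]. *)
Definition slice v e g : {mpoly F[N]} :=
  \sum_(b <- msupp g | b v == e) g@_b *: 'X_[b - U_(v) *+ e].

Lemma msupp_slice v e g b : b \in msupp (slice v e g) ->
  exists2 b', b' \in msupp g & b' v = e /\ b = (b' - U_(v) *+ e)%MM.
Proof.
move=> /msupp_sum_le /flattenP [s] /mapP [b'].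
rewrite mem_filter => /andP[/eqP hv hb'] -> /msuppZ_le.
by rewrite msuppX inE => /eqP ->; exists b'.
Qed.

Lemma mcoeff_slice v e g b : b v = e -> (slice v e g)@_(b - U_(v) *+ e) = g@_b.
Proof.
move=> hv; rewrite raddf_sum /=.
have inj (x : 'X_{1..N}) : x v = e ->
    ((x - U_(v) *+ e)%MM == (b - U_(v) *+ e)%MM) = (x == b).
  move=> hx; apply/eqP/eqP => [/mnmP h|-> //]; apply/mnmP => q.
  have := h q; rewrite !mnmBE mulmnE mnm1E; case: eqP => [<-|_].
    by rewrite hv hx.
  by rewrite mul0n !subn0.
have [hb|hb] := boolP (b \in msupp g).
  rewrite big_mkcond (bigD1_seq b) ?msupp_uniq //= hv eqxx mcoeffZ mcoeffX eqxx mulr1.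
  rewrite big1 ?addr0 // => x /negbTE nx; case: eqP => // hx.
  by rewrite mcoeffZ mcoeffX inj // nx mulr0.
rewrite (memN_msupp_eq0 hb) big_seq_cond big1 // => x /andP[hx /eqP hxv].
rewrite mcoeffZ mcoeffX inj //; case: eqP hx hb => [->|_]; rewrite ?mulr0 //.
by move=> ->.
Qed.

Lemma mmap_slice (A : comNzRingType) (iota : {rmorphism F -> A}) v e g
    (P : 'I_N -> {poly A}) (u : {poly A}) :
  (forall b, b \in msupp g -> (e <= b v)%N) -> P v = 'X * u ->
  exists2 Q : {poly A}, mmap (polyC \o iota) P g = ('X * u) ^+ e * Q
    & Q.[0] = mmap iota (fun q => (P q).[0]) (slice v e g).
Proof.
move=> he hP.
exists (\sum_(b <- msupp g)
   (iota g@_b)%:P * (('X * u) ^+ (b v - e) * \prod_(q | q != v) P q ^+ b q)).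
  rewrite /mmap mulr_sumr big_seq [RHS]big_seq; apply: eq_bigr => b hb.
  rewrite mulrCA; congr (_ * _).
  by rewrite /mmap1 (bigD1 v) //= hP mulrA -exprD subnKC // he.
rewrite horner_sum raddf_sum /= [RHS]big_mkcond big_seq [RHS]big_seq.
apply: eq_bigr => b hb; rewrite hornerM hornerC hornerM horner_exp hornerM hornerX.
(* A monomial with [b v > e] keeps a factor ['X], so only those with [b v = e] survive at 0. *)
rewrite mul0r expr0n subn_eq0 leq_eqVlt ltnNge he // orbF.
case: eqP => [hv|_]; last by rewrite mul0r mulr0.
rewrite mmapZ mmapX mul1r horner_prod; congr (_ * _).
rewrite /mmap1 [RHS](bigD1 v) //= mnmBE mulmnE mnm1E eqxx mul1n hv subnn mul1r.
apply: eq_bigr => q nqv; rewrite horner_exp; congr (_ ^+ _).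
by rewrite mnmBE mulmnE mnm1E eq_sym (negbTE nqv) mul0n subn0.
Qed.

End Slice.

Section MatrixPoints.
Variables (k n : nat) (F : fieldType).
Implicit Types (g : {mpoly F[k * n]}) (b : 'X_{1..k * n}).

Definition eval_mx (A : comNzRingType) (iota : {rmorphism F -> A}) (M : 'M[A]_(k, n)) :=
  mmap iota (fun q => mxvec M 0 q).

Definition subrow (A : nzRingType) (i i' : 'I_k) (M : 'M[A]_(k, n)) : 'M[A]_(k, n) :=
  \matrix_(a, b) (M a b - (if a == i' then M i b else 0)).

Definition scalerow (A : nzRingType) (i : 'I_k) (z : A) (M : 'M[A]_(k, n)) : 'M[A]_(k, n) :=
  \matrix_(a, b) ((if a == i then z else 1) * M a b).

Definition rowdeg (i : 'I_k) b : nat := (\sum_j b (mxvec_index i j))%N.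

Lemma mmap1_mxvec (A : comNzRingType) (M : 'M[A]_(k, n)) b :
  mmap1 (fun q => mxvec M 0 q) b = \prod_i \prod_j M i j ^+ b (mxvec_index i j).
Proof.
rewrite pair_bigA /mmap1 (reindex _ (curry_mxvec_bij _ _)) /=.
by apply: eq_bigr => -[i j] _; rewrite mxvecE.
Qed.

Lemma eval_scalerow (A : comNzRingType) (iota : {rmorphism F -> A}) M i z r g :
  (forall b, b \in msupp g -> rowdeg i b = r) ->
  eval_mx iota (scalerow i z M) g = z ^+ r * eval_mx iota M g.
Proof.
move=> hr; rewrite /eval_mx /mmap mulr_sumr big_seq [RHS]big_seq.
apply: eq_bigr => b hb; rewrite mulrCA; congr (_ * _); rewrite !mmap1_mxvec.
rewrite (bigD1 i) //= [in RHS](bigD1 i) //= mulrA; congr (_ * _).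
  rewrite -(hr b hb) expr_sum -big_split /=; apply: eq_bigr => j _.
  by rewrite mxE eqxx exprMn.
apply: eq_bigr => a /negbTE na; apply: eq_bigr => j _.
by rewrite mxE na mul1r.
Qed.

(** Only row [i] depends on the indeterminate, and at most linearly, so each monomial contributes at
    most its degree in that row. *)
Lemma size_eval_mx (A : comNzRingType) (iota : {rmorphism F -> {poly A}})
    (M : 'M[{poly A}]_(k, n)) i r g :
  (forall c, (size (iota c) <= 1)%N) ->
  (forall a j, (size (M a j) <= (a == i).+1)%N) ->
  (forall b, b \in msupp g -> rowdeg i b = r) ->
  (size (eval_mx iota M g) <= r.+1)%N.
Proof.
move=> hi hM hr.
have szM (p q : {poly A}) x y : (size p <= x.+1)%N -> (size q <= y.+1)%N ->
    (size (p * q)%R <= (x + y).+1)%N.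
  move=> hp hq; apply: leq_trans (size_polyMleq _ _) _; lia.
rewrite /eval_mx /mmap big_seq; apply: leq_trans (size_sum _ _ _) _.
apply/bigmax_leqP_seq => b _ hb; rewrite -[r]add0n; apply: (szM) => //.
rewrite mmap1_mxvec -(hr b hb).
have -> : rowdeg i b = (\sum_a if a == i then rowdeg a b else 0)%N.
  by rewrite -big_mkcond /= big_pred1_eq.
apply: (big_ind2 (fun (p : {poly A}) x => (size p <= x.+1)%N)).
- by rewrite size_poly1.
- by move=> p x q y; apply: (szM).
move=> a _; have -> : (if a == i then rowdeg a b else 0)%N =
    (\sum_j (a == i) * b (mxvec_index a j))%N.
  by rewrite -big_distrr /=; case: eqP => _; rewrite ?mul1n.
apply: (big_ind2 (fun (p : {poly A}) x => (size p <= x.+1)%N)).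
- by rewrite size_poly1.
- by move=> p x q y; apply: (szM).
move=> j _; elim: (b _) => [|d IH]; first by rewrite expr0 size_poly1.
by rewrite exprS mulnS; apply: (szM).
Qed.

Variable pos : 'I_(k * n) -> nat.
Hypothesis pos_inj : injective pos.
Hypothesis posS : forall (i i' : 'I_k) j, i' = i.+1 :> nat ->
  pos (mxvec_index i' j) = (pos (mxvec_index i j)).+1.

(* Quantifying over all rings allows indeterminates as entries of the points. *)
Definition row_invariant (c : nat) g : Prop :=
  forall (A : comNzRingType) (iota : {rmorphism F -> A}) (M : 'M[A]_(k, n)) (i i' : 'I_k),
    i' = i.+1 :> nat -> (forall a j, (pos (mxvec_index a j) < c)%N -> M a j = 0) ->
    eval_mx iota (subrow i i' M) g = eval_mx iota M g.

(** Put an indeterminate at the entry of position [c] and apply the invariance of [g] over the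
    polynomial ring. Both values are divisible by the [e]-th power of the indeterminate; cancel it
    and set the indeterminate to 0. *)
Lemma row_invariant_slice c g i m e : pos (mxvec_index i m) = c ->
  (forall b, b \in msupp g -> (e <= b (mxvec_index i m))%N) ->
  row_invariant c g -> row_invariant c.+1 (slice (mxvec_index i m) e g).
Proof.
move=> hc he inv A iota M i1 i2 hi hM.
set v := mxvec_index i m in hc he *.
pose M' : 'M[{poly A}]_(k, n) :=
  \matrix_(a, j) (if (a == i) && (j == m) then 'X else (M a j)%:P).
have Mv : M i m = 0 by apply: hM; rewrite -/v hc.
have hM' : forall a j, (pos (mxvec_index a j) < c)%N -> M' a j = 0.
  move=> a j h; rewrite mxE; case: ifP => [/andP[/eqP ea /eqP ej]|_].
    by rewrite ea ej -/v hc ltnn in h.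
  by rewrite hM // ltnW.
have M'v : mxvec M' 0 v = 'X * 1 by rewrite mxvecE mxE !eqxx mulr1.
have sM'v : mxvec (subrow i1 i2 M') 0 v = 'X * 1.
  rewrite mxvecE mxE [X in X - _]mxE !eqxx mulr1.
  (* If row [i] is the one being changed, the entry subtracted from the indeterminate has position
     [c - 1], hence is zero. *)
  case: eqP => [e2|_]; last by rewrite subr0.
  by rewrite hM' ?subr0 // -hc /v e2 (posS m hi).
have [Q eQ Q0] := mmap_slice iota he M'v.
have [Q' eQ' Q'0] := mmap_slice iota he sM'v.
have M'0 a j : (M' a j).[0] = M a j.
  rewrite mxE; case: ifP => [/andP[/eqP -> /eqP ->]|_]; last by rewrite hornerC.
  by rewrite hornerX Mv.
(* The ring [A] may have zero divisors, but powers of ['X] are monic and hence regular. *)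
have eQQ : Q' = Q.
  have := inv _ (polyC \o iota) M' i1 i2 hi hM'; rewrite /eval_mx eQ eQ' mulr1.
  exact: (monic_lreg (monicXn _ _)).
rewrite /eval_mx.
have -> : mmap iota (fun q => mxvec M 0 q) (slice v e g) = Q.[0].
  rewrite Q0; apply: eq_bigr => b _; congr (_ * _); apply: mmap1_eq => q.
  by case/mxvec_indexP: q => a j; rewrite !mxvecE M'0.
rewrite -eQQ Q'0; apply: eq_bigr => b _; congr (_ * _); apply: mmap1_eq => q.
case/mxvec_indexP: q => a j; rewrite !mxvecE [LHS]mxE [X in _ = X.[0]]mxE.
by rewrite hornerD hornerN M'0; case: ifP => _; rewrite ?horner0 ?M'0.
Qed.

Lemma eval_generic (c : nat) g :
  (forall b q, b \in msupp g -> (pos q < c)%N -> b q = 0%N) ->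
  eval_mx (@mpolyC _ F)
    (\matrix_(a, j) (if (pos (mxvec_index a j) < c)%N then 0 else 'X_(mxvec_index a j))) g
  = g.
Proof.
move=> hg; rewrite {2}(mpolyE g) /eval_mx /mmap big_seq [RHS]big_seq.
apply: eq_bigr => b hb; rewrite mul_mpolyC; congr (_ *: _).
rewrite -mmap1_id; apply: eq_bigr => q _.
case/mxvec_indexP: q => a j; rewrite mxvecE mxE; case: ifP => // h.
by rewrite (hg b) // !expr0.
Qed.

(* In rows [i] and [i+1] of a point, let [x] be a vector vanishing at [m] and
   [z] an indeterminate. Invariance gives
   [g (x + z y, - x) = g (x + z y, z y) = z ^ r' g (x + z y, y)], where the left
   side has degree at most [r] in [z], while [g (x + z y, y)] is divisible by [z ^ e]. *)
Lemma row_invariant_bound_at c g (i i' : 'I_k) m e r r'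
    (A : idomainType) (iota : {rmorphism F -> A}) (T : 'M[A]_(k, n)) :
  i' = i.+1 :> nat -> pos (mxvec_index i m) = c -> row_invariant c g ->
  (forall b, b \in msupp g -> (e <= b (mxvec_index i m))%N) ->
  (forall b, b \in msupp g -> rowdeg i b = r) ->
  (forall b, b \in msupp g -> rowdeg i' b = r') ->
  (forall a j, (pos (mxvec_index a j) <= c)%N -> T a j = 0) -> T i' m != 0 ->
  eval_mx iota T (slice (mxvec_index i m) e g) != 0 -> (r' + e <= r)%N.
Proof.
move=> hi hc inv he hr hr' hT Tnz nz.
set v := mxvec_index i m in hc he nz *.
pose M : 'M[{poly A}]_(k, n) := \matrix_(a, j)
  ((T a j)%:P + (if a == i then 'X * (T i' j)%:P else 0)).
have nii : (i' == i) = false.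
  by apply/eqP => h; move: hi; rewrite h => /n_Sn.
have Tv : T i m = 0 by apply: hT; rewrite -/v hc.
have Mv : mxvec M 0 v = 'X * (T i' m)%:P.
  by rewrite mxvecE mxE eqxx Tv add0r.
have [Q eQ Q0] := mmap_slice iota he Mv.
have Qnz : Q.[0] != 0.
  rewrite Q0; suff -> : mmap iota (fun q => (mxvec M 0 q).[0]) (slice v e g) =
    eval_mx iota T (slice v e g) by [].
  apply: eq_bigr => b _; congr (_ * _); apply: mmap1_eq => q.
  case/mxvec_indexP: q => a j; rewrite !mxvecE mxE hornerD hornerC.
  case: ifP => _; last by rewrite horner0 addr0.
  by rewrite hornerM hornerX mul0r addr0.
pose M1 := scalerow i' 'X M.
have M1_0 a j : (pos (mxvec_index a j) < c)%N -> M1 a j = 0.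
  move=> h; rewrite mxE; apply/eqP; rewrite mulf_eq0; apply/orP; right; apply/eqP.
  rewrite mxE hT ?(ltnW h) // add0r; case: eqP => // ea.
  (* Below an entry of row [i] at a position less than [c] lies one at a position at most [c], where
     [T] vanishes too. *)
  by rewrite hT ?mulr0 // (posS j hi) -ea.
have inv1 := inv _ (polyC \o iota) M1 i i' hi M1_0.
rewrite (eval_scalerow _ _ _ hr') [X in _ * X]eQ in inv1.
(* After the subtraction, row [i'] is minus row [i] of [T]: the indeterminate remains in row [i]
   only. *)
have sz : (size (eval_mx (polyC \o iota) (subrow i i' M1) g) <= r.+1)%N.
  apply: (@size_eval_mx _ _ _ i) => // [x|a j]; first exact: size_polyC_leq1.
  have -> : subrow i i' M1 a j = if a == i' then - (T i j)%:P else M a j.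
    rewrite [LHS]mxE [M1 a j]mxE [M1 i j]mxE eq_sym [i == _]eq_sym nii.
    rewrite eq_sym; case: eqP => [->|_]; last by rewrite subr0 mul1r.
    rewrite mul1r [M i' j]mxE [M i j]mxE nii eqxx addr0.
    by rewrite opprD addrCA subrr addr0.
  case: eqP => [->|na]; first by rewrite nii size_polyN size_polyC_leq1.
  rewrite mxE; case: eqP => _; last by rewrite addr0 size_polyC_leq1.
  rewrite (leq_trans (size_polyD _ _)) // geq_max.
  rewrite (leq_trans (size_polyC_leq1 _)) //=.
  by rewrite (leq_trans (size_polyMleq _ _)) // size_polyX ltnS size_polyC_leq1.
(* The value is now the power [r' + e] of the indeterminate times a factor [w]; since [w] is
   nonzero, its degree is at least [r' + e]. *)
rewrite inv1 exprMn !mulrA -exprD -polyC_exp -mulrA mulrC in sz.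
set w := _ * Q in sz.
have wnz : w != 0.
  rewrite mulf_neq0 // ?polyC_eq0 ?expf_neq0 //.
  by apply: contraNneq Qnz => ->; rewrite horner0.
rewrite size_mulXn // in sz; rewrite -size_poly_gt0 in wnz; lia.
Qed.

(** Take for [T] the generic point with zeros at all positions up to [c]. The slice is free of the
    variables there, so its value at [T] is itself; the entry [(i', m)], at position [c + 1], is
    still a variable. *)
Lemma row_invariant_bound c g (i i' : 'I_k) m e r r' : i' = i.+1 :> nat ->
  pos (mxvec_index i m) = c -> row_invariant c g ->
  (forall b, b \in msupp g -> (e <= b (mxvec_index i m))%N) ->
  (forall b q, b \in msupp g -> (pos q < c)%N -> b q = 0%N) ->
  (forall b, b \in msupp g -> rowdeg i b = r) ->
  (forall b, b \in msupp g -> rowdeg i' b = r') ->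
  slice (mxvec_index i m) e g != 0 -> (r' + e <= r)%N.
Proof.
move=> hi hc inv he hg hr hr' nz.
pose T : 'M[{mpoly F[k * n]}]_(k, n) := \matrix_(a, j)
  (if (pos (mxvec_index a j) < c.+1)%N then 0 else 'X_(mxvec_index a j)).
apply: (@row_invariant_bound_at c g i i' m e r r' _ (@mpolyC _ F) T) => //.
- by move=> a j h; rewrite mxE ltnS h.
- rewrite mxE (posS m hi) hc ltnn -msupp_eq0 msuppX //.
rewrite eval_generic // => b q /msupp_slice [b' hb' [ev ->]].
rewrite mnmBE mulmnE mnm1E ltnS leq_eqVlt => /orP[|h]; last by rewrite (hg b').
by rewrite -hc => /eqP /pos_inj ->; rewrite eqxx mul1n ev subnn.
Qed.

(* [g] is what is left of a polynomial once the variables at positions below [c]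
   are eliminated, and [a] what is left of its leading exponent. *)
Definition stage c g (a : 'X_{1..k * n}) : Prop :=
  [/\ row_invariant c g, a \in msupp g & forall b, b \in msupp g ->
    [/\ forall q, (pos q < c)%N -> b q = 0%N, forall i, rowdeg i b = rowdeg i a
      & forall v, (forall q, (pos q < pos v)%N -> b q = a q) -> (a v <= b v)%N]].

Lemma stage_min c g a v : stage c g a -> pos v = c ->
  forall b, b \in msupp g -> (a v <= b v)%N.
Proof.
move=> [_ ha hg] hv b hb; have [hb0 _] := hg b hb; apply => q; rewrite hv => hq.
by have [ha0 _ _] := hg a ha; rewrite hb0 ?ha0.
Qed.

Lemma rowdegB i b (x : 'X_{1..k * n}) : (forall q, (x q <= b q)%N) ->
  rowdeg i b = (rowdeg i (b - x)%MM + rowdeg i x)%N.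
Proof.
move=> hx; rewrite -big_split; apply: eq_bigr => j _.
by rewrite /= mnmBE subnK.
Qed.

(** All exponents kept by the slice agree with [a] at [v]. They are shifted by the same multiple of
    [U_(v)] as [a], so row degrees and comparisons persist. *)
Lemma stage_slice c g a v : stage c g a -> pos v = c ->
  stage c.+1 (slice v (a v) g) (a - U_(v) *+ a v)%MM.
Proof.
move=> st hv; have hmin := stage_min st hv; have [inv ha hg] := st; split.
- by move: hv hmin; case/mxvec_indexP: v => i m hv hmin; apply: row_invariant_slice.
- by rewrite mcoeff_msupp mcoeff_slice // -mcoeff_msupp.
have sub (x : 'X_{1..k * n}) : x v = a v -> forall q, ((U_(v) *+ a v)%MM q <= x q)%N.
  by move=> hx q; rewrite mulmnE mnm1E; case: eqP => [<-|//]; rewrite mul1n hx.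
move=> _ /msupp_slice [b hb [hbv ->]]; have [hb0 hbr hbm] := hg b hb; split.
- move=> q; rewrite ltnS leq_eqVlt mnmBE mulmnE mnm1E => /orP[|h].
    by rewrite -hv => /eqP /pos_inj ->; rewrite eqxx mul1n hbv subnn.
  by rewrite hb0.
- move=> i; apply/eqP; rewrite -(eqn_add2r (rowdeg i (U_(v) *+ a v)%MM)).
  by rewrite -!rowdegB ?hbr //; apply: sub.
move=> w hw; rewrite !mnmBE leq_sub2r // hbm // => q /hw.
by rewrite !mnmBE mulmnE mnm1E; case: eqP => [<-|_]; rewrite ?subn0.
Qed.

Definition mtrunc c (a : 'X_{1..k * n}) : 'X_{1..k * n} :=
  [multinom (if (pos q < c)%N then 0 else a q)%N | q < k * n].

Lemma stage_mtrunc f a c : stage 0 f a -> exists g, stage c g (mtrunc c a).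
Proof.
move=> st; elim: c => [|c [g IH]].
  exists f; suff -> : mtrunc 0 a = a by [].
  by apply/mnmP => q; rewrite mnmE.
have [v /eqP hv|no] := pickP (fun v => pos v == c).
  have := stage_slice IH hv.
  suff -> : (mtrunc c a - U_(v) *+ mtrunc c a v)%MM = mtrunc c.+1 a by exists (slice v (mtrunc c a v) g).
  apply/mnmP => q; rewrite mnmBE mulmnE mnm1E !mnmE hv ltnn ltnS [(pos q <= c)%N]leq_eqVlt -hv.
  rewrite (inj_eq pos_inj) eq_sym; case: eqP => [->|_] /=; last by rewrite subn0.
  by rewrite ltnn mul1n subnn.
(* Here no variable sits at position [c], so there is nothing to eliminate. *)
exists g; suff -> : mtrunc c.+1 a = mtrunc c a.
  have [inv ha hg] := IH; split=> //.
    by move=> A iota M i i' hi hM; apply: inv => // x j h; apply: hM; apply: ltnW.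
  move=> b hb; have [hb0 h1 h2] := hg b hb; split=> // q.
  by rewrite ltnS leq_eqVlt [_ == c]no => /hb0.
by apply/mnmP => q; rewrite !mnmE ltnS [(pos q <= c)%N]leq_eqVlt [_ == c]no.
Qed.

(** Once the positions before that of [(i, m)] are eliminated, the two sums are row degrees and [a]
    at [(i, m)] is the least exponent of that variable, so [row_invariant_bound] applies. *)
Lemma stage_bound f a (i i' : 'I_k) m : stage 0 f a -> i' = i.+1 :> nat ->
  (\sum_(j | (pos (mxvec_index i m) <= pos (mxvec_index i' j))%N) a (mxvec_index i' j)
    + a (mxvec_index i m) <=
   \sum_(j | (pos (mxvec_index i m) <= pos (mxvec_index i j))%N) a (mxvec_index i j))%N.
Proof.
move=> st hi; set v := mxvec_index i m.
have [g stg] := stage_mtrunc (pos v) st.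
have [inv hag hg] := stg.
have rowdegE x : (\sum_(j | (pos v <= pos (mxvec_index x j))%N) a (mxvec_index x j))%N
    = rowdeg x (mtrunc (pos v) a).
  rewrite big_mkcond; apply: eq_bigr => j _.
  by rewrite mnmE leqNgt; case: ltnP.
have -> : a v = mtrunc (pos v) a v by rewrite mnmE ltnn.
rewrite !rowdegE; apply: (row_invariant_bound hi (erefl _) inv).
- exact: stage_min stg _.
- by move=> b q hb; have [h _ _] := hg b hb; apply: h.
- by move=> b hb; have [_ h _] := hg b hb; apply: h.
- by move=> b hb; have [_ h _] := hg b hb; apply: h.
(* The slice is nonzero because the truncated leading exponent survives in it. *)
rewrite -/v -msupp_eq0; apply/eqP => e.
suff : (mtrunc (pos v) a - U_(v) *+ mtrunc (pos v) a v)%MM \in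
    msupp (slice v (mtrunc (pos v) a v) g) by rewrite e.
by rewrite mcoeff_msupp mcoeff_slice // -mcoeff_msupp.
Qed.

End MatrixPoints.

(** * The semigroup of diagonal monomials *)

Section DiagonalMonomials.
Variables k n : nat.
Implicit Types (l : 'I_'C(n, k)).

Lemma minor_cols_lt l (i i' : 'I_k) : (i < i')%N ->
  (tnth (minor_cols l) i < tnth (minor_cols l) i')%N.
Proof.
move=> hii; have := enum_valP (cast_ord (esym (card_ltn_sorted_tuples k n)) l).
rewrite -/(minor_cols l) inE => srt.
have x0 : 'I_n := tnth (minor_cols l) i.
rewrite !(tnth_nth x0) -!(nth_map x0 0%N val) ?size_tuple //.
by apply: (sorted_ltn_nth ltn_trans) => //; rewrite inE size_map size_tuple.
Qed.

Lemma minor_cols_onto (J : 'I_k -> 'I_n) :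
  (forall i i' : 'I_k, i' = i.+1 :> nat -> (J i < J i')%N) ->
  exists l, forall i, tnth (minor_cols l) i = J i.
Proof.
move=> hJ; pose t := [tuple J i | i < k].
have ht : t \in [set t : k.-tuple 'I_n | sorted ltn (map val t)].
  rewrite inE; apply/(sortedP 0%N) => i; rewrite size_map size_tuple => hi.
  have hi' := ltnW hi.
  have x0 : 'I_n := J (Ordinal hi).
  rewrite !(nth_map x0) ?size_tuple //.
  have e x (hx : (x < k)%N) : nth x0 t x = J (Ordinal hx).
    by rewrite -[x]/(val (Ordinal hx)) -tnth_nth tnth_mktuple.
  by rewrite (e _ hi) (e _ hi'); apply: hJ.
exists (cast_ord (card_ltn_sorted_tuples k n) (enum_rank_in ht t)) => i.
by rewrite /minor_cols cast_ordK enum_rankK_in // tnth_mktuple.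
Qed.

Definition rv_mnm (u : 'rV[nat]_(k * n)) : 'X_{1..k * n} := [multinom u 0%R q | q < k * n].
Definition mnm_rv (a : 'X_{1..k * n}) : 'rV[nat]_(k * n) := \row_q a q.

Lemma rv_mnmK : cancel rv_mnm mnm_rv.
Proof. by move=> u; apply/rowP => q; rewrite mxE mnmE. Qed.

Lemma mnm_rvK : cancel mnm_rv rv_mnm.
Proof. by move=> a; apply/mnmP => q; rewrite mnmE mxE. Qed.

Lemma rv_mnmD u w : rv_mnm (u + w) = (rv_mnm u + rv_mnm w)%MM.
Proof. by apply/mnmP => q; rewrite mnmDE !mnmE mxE. Qed.

Lemma mnm_rvD a b : mnm_rv (a + b)%MM = mnm_rv a + mnm_rv b.
Proof. by apply: (can_inj rv_mnmK); rewrite rv_mnmD !mnm_rvK. Qed.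

Definition diag_mnm l : 'X_{1..k * n} := rv_mnm (row l (diag_mx_exponents k n)).

Lemma diag_mnmE l (i : 'I_k) j :
  diag_mnm l (mxvec_index i j) = (j == tnth (minor_cols l) i).
Proof. by rewrite mnmE mxE mxE mxvecE mxE. Qed.

Lemma row_in_Gamma l : row l (diag_mx_exponents k n) \in in_Gamma k n.
Proof. by apply/asboolP; exists (delta_mx 0 l); rewrite rowE. Qed.

(** Induction on the common row sum. If [J i] is the leftmost column occupied in row [i], the
    inequality at [m = J i'] yields an entry of row [i] strictly left of [J i']; so [J] increases
    and its diagonal monomial can be removed. *)
Lemma interlacing_in_Gamma d (a : 'X_{1..k * n}) : (forall i, rowdeg i a = d) ->
  (forall (i i' : 'I_k) (m : 'I_n), i' = i.+1 :> nat ->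
     (\sum_(j < n | (j <= m)%N) a (mxvec_index i' j) <=
      \sum_(j < n | (j < m)%N) a (mxvec_index i j))%N) ->
  mnm_rv a \in in_Gamma k n.
Proof.
elim: d a => [|d IH] a hr hi.
  have -> : mnm_rv a = 0; last exact: rpred0.
  apply/rowP => q; case/mxvec_indexP: q => i j; rewrite !mxE.
  by have /eqP := hr i; rewrite sum_nat_eq0 => /forallP /(_ j) /eqP.
have ex i : exists j, (0 < a (mxvec_index i j))%N.
  apply/existsP; have := hr i; apply: contraPT => /existsPn h.
  by rewrite /rowdeg big1 // => j _; move: (h j); case: (a _).
pose J i := [arg min_(j < xchoose (ex i) | (0 < a (mxvec_index i j))%N) (j : nat)].
have JP i : (0 < a (mxvec_index i (J i)))%N /\
    forall j, (0 < a (mxvec_index i j))%N -> (J i <= j)%N.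
  by rewrite /J; case: arg_minnP => //; exact: (xchooseP (ex i)).
have [l hl] : exists l, forall i, tnth (minor_cols l) i = J i.
  apply: minor_cols_onto => i i' hii.
  have : (0 < \sum_(j < n | (j < J i')%N) a (mxvec_index i j))%N.
    apply: leq_trans (hi i i' (J i') hii).
    by rewrite (bigD1 (J i')) //= addn_gt0 (JP i').1.
  rewrite lt0n sum_nat_eq0 => /forallPn [j]; rewrite negb_imply -lt0n => /andP[hj ha].
  exact: leq_ltn_trans ((JP i).2 j ha) hj.
have le_diag q : (diag_mnm l q <= a q)%N.
  case/mxvec_indexP: q => i j; rewrite diag_mnmE hl.
  by case: eqP => // ->; exact: (JP i).1.
have -> : a = ((a - diag_mnm l) + diag_mnm l)%MM.
  by apply/mnmP => q; rewrite mnmDE mnmBE subnK.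
rewrite mnm_rvD rpredD //; last by rewrite rv_mnmK row_in_Gamma.
have rd i : rowdeg i (diag_mnm l) = 1%N.
  rewrite /rowdeg; under eq_bigr => j _ do rewrite diag_mnmE.
  by rewrite -big_mkcond /= big_pred1_eq.
apply: IH => [i|i i' m hii].
  by apply/eqP; rewrite -(eqn_add2r 1%N) -{1}(rd i) -rowdegB // hr addn1.
have sumB i0 (P : pred 'I_n) :
    (\sum_(j < n | P j) (a - diag_mnm l)%MM (mxvec_index i0 j) =
    \sum_(j < n | P j) a (mxvec_index i0 j) - P (J i0))%N.
  apply/eqP; rewrite -(eqn_add2r (P (J i0))).
  have -> : P (J i0) = (\sum_(j < n | P j) diag_mnm l (mxvec_index i0 j))%N :> nat.
    under eq_bigr => j _ do rewrite diag_mnmE hl.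
    rewrite -big_mkcondr /=; case: (boolP (P (J i0))) => h.
      rewrite (bigD1 (J i0)) ?h ?eqxx //= big1 // => j /andP[/andP[_ ->]].
      by [].
    by rewrite big1 // => j /andP[hj /eqP e]; rewrite -e hj in h.
  rewrite -big_split subnK ?leq_sum //=.
  by apply/eqP/eq_bigr => j _; rewrite mnmBE subnK.
rewrite !sumB; have := hi i i' m hii.
(* If [J i' <= m], the left side drops by 1 and the right side by at most 1. Otherwise row [i'] is
   empty up to column [m]. *)
case: (leqP (J i') m) => h; first by case: (_ < m)%N; lia.
move=> _; rewrite big1 // => j hj; apply/eqP; rewrite -leqn0 leqNgt.
by apply/negP => /(JP i').2; lia.
Qed.

End DiagonalMonomials.

(** * Leading monomials of polynomials in the minors *)

Lemma eq_mxvec_index k n (i i' : 'I_k) (j j' : 'I_n) :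
  (mxvec_index i j == mxvec_index i' j') = (i == i') && (j == j').
Proof. by rewrite (inj_eq (@cast_ord_inj _ _ _)) (inj_eq enum_rank_inj) xpair_eqE. Qed.

(** By linearity in row [i'], the two sides differ by a determinant whose rows [i] and [i']
    coincide. *)
Lemma det_colsub_subrow (A : comNzRingType) k n (f : 'I_k -> 'I_n) (i i' : 'I_k)
    (M : 'M[A]_(k, n)) : i != i' -> \det (colsub f (subrow i i' M)) = \det (colsub f M).
Proof.
move=> nii.
pose C : 'M[A]_k := \matrix_(a, b) M (if a == i' then i else a) (f b).
rewrite (@determinant_multilinear _ _ _ (colsub f M) C i' 1 (- 1)).
- rewrite mul1r [\det C](@determinant_alternate _ _ _ i i') ?mulr0 ?addr0 //.
  by move=> b; rewrite !mxE (negbTE nii) eqxx.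
- by apply/rowP => b; rewrite !mxE !eqxx mul1r mulN1r.
- apply/matrixP => a b; rewrite !mxE; case: eqP => [e|_]; last by rewrite subr0.
  by case/eqP: (neq_lift i' a).
apply/matrixP => a b; rewrite !mxE; case: eqP => [e|_]; last by rewrite subr0.
by case/eqP: (neq_lift i' a).
Qed.

(** Increase gives [i <= s i]. Descending from the top, [i < s i] would make [s i] a fixed point,
    against injectivity. *)
Lemma perm_incr_id k (s : 'S_k) :
  (forall i i' : 'I_k, i' = i.+1 :> nat -> (s i < s i')%N) -> forall i, s i = i.
Proof.
move=> hs.
have ge (x : nat) (hx : (x < k)%N) : (x <= s (Ordinal hx))%N.
  elim: x hx => // x IH hx; apply: leq_ltn_trans (IH (ltnW hx)) _; exact: hs.
have fix_top m : forall i : 'I_k, (k - i <= m)%N -> s i = i.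
  elim: m => [|m IH] i hi; first by have := ltn_ord i; lia.
  have hx : (i <= s i)%N by have := ge i (ltn_ord i); rewrite (_ : Ordinal _ = i) //; apply: val_inj.
  apply/eqP/negPn/negP => n_si.
  have lt_i : (i < s i)%N by rewrite ltn_neqAle hx andbT eq_sym.
  have : s (s i) = s i by apply: IH; have := ltn_ord (s i); lia.
  by move/perm_inj/eqP; rewrite (negbTE n_si).
by move=> i; apply: (fix_top k); apply: leq_subr.
Qed.

Section GenericMinors.
Variables (F : fieldType) (k n : nat).
Hypothesis k_gt0 : (0 < k)%N.
Implicit Types (l : 'I_'C(n, k)) (p : {mpoly F['C(n, k)]}).

Definition generic_mx : 'M[{mpoly F[k * n]}]_(k, n) := \matrix_(i, j) 'X_(mxvec_index i j).

Definition minor l : {mpoly F[k * n]} :=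
  \det (colsub (tnth (minor_cols l)) generic_mx).

Definition to_minors p : {mpoly F[k * n]} := mmap (@mpolyC (k * n) F) minor p.

HB.instance Definition _ :=
  GRing.RMorphism.copy to_minors (mmap (@mpolyC (k * n) F) minor).

Lemma eval_to_minors (A : comNzRingType) (iota : {rmorphism F -> A}) (M : 'M[A]_(k, n)) p :
  eval_mx iota M (to_minors p) =
  mmap iota (fun l => \det (colsub (tnth (minor_cols l)) M)) p.
Proof.
rewrite /eval_mx {1}/to_minors {2}/mmap raddf_sum /=; apply: eq_bigr => m _.
rewrite rmorphM /= mmapC; congr (_ * _); rewrite /mmap1 rmorph_prod /=.
apply: eq_bigr => l _; rewrite rmorphXn /=; congr (_ ^+ _).
rewrite /minor -det_map_mx; congr (\det _); apply/matrixP => i j.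
by rewrite !mxE /= mmapX mmap1U mxvecE.
Qed.

Lemma row_invariant_to_minors pos p : row_invariant pos 0 (to_minors p).
Proof.
move=> A iota M i i' hi _; rewrite !eval_to_minors.
apply: eq_bigr => m _; congr (_ * _); apply: mmap1_eq => l.
by apply: det_colsub_subrow; apply/eqP => e; move: hi; rewrite e => /n_Sn.
Qed.

Lemma msupp_minor l b : b \in msupp (minor l) ->
  exists s : 'S_k, b = (\sum_i U_(mxvec_index i (tnth (minor_cols l) (s i))))%MM.
Proof.
rewrite /minor /determinant => /msupp_sum_le /flattenP [t] /mapP [s _ ->].
rewrite -signr_odd; under eq_bigr => i _ do rewrite !mxE.
rewrite mprodXE mulr_sign => h; exists s; move: h.
by case: ifP => _; rewrite ?(perm_mem (msuppN _)) msuppX inE => /eqP.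
Qed.

Definition row_homog d (g : {mpoly F[k * n]}) : Prop :=
  forall b, b \in msupp g -> forall i : 'I_k, rowdeg i b = d.

Lemma rowdegD (i : 'I_k) (a b : 'X_{1..k * n}) :
  rowdeg i (a + b)%MM = (rowdeg i a + rowdeg i b)%N.
Proof. by rewrite -big_split; apply: eq_bigr => j _; rewrite /= mnmDE. Qed.

Lemma rowdeg0 (i : 'I_k) : rowdeg i (0%MM : 'X_{1..k * n}) = 0%N.
Proof. by rewrite /rowdeg big1 // => j _; rewrite mnm0E. Qed.

Lemma rowdegU (i i' : 'I_k) (j : 'I_n) : rowdeg i U_(mxvec_index i' j)%MM = (i' == i).
Proof.
rewrite /rowdeg; under eq_bigr => j' _ do rewrite mnm1E eq_mxvec_index.
case: eqVneq => _; last by rewrite big1.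
by under eq_bigr => j' _ do rewrite eq_sym; rewrite -big_mkcond /= big_pred1_eq.
Qed.

Lemma mdeg_rowdeg (b : 'X_{1..k * n}) : mdeg b = (\sum_(i < k) rowdeg i b)%N.
Proof.
by rewrite mdegE pair_bigA (reindex _ (curry_mxvec_bij _ _)) /=; apply: eq_bigr => -[].
Qed.

Lemma row_homog1 : row_homog 0 1.
Proof.
by move=> b; rewrite msupp1 inE => /eqP -> i; apply: rowdeg0.
Qed.

Lemma row_homogM d e f g : row_homog d f -> row_homog e g -> row_homog (d + e) (f * g).
Proof.
move=> hf hg b /msuppM_le /allpairsP [[x y] /= [hx hy ->]] i.
by rewrite rowdegD hf // hg.
Qed.

Lemma row_homog_minor l : row_homog 1 (minor l).
Proof.
move=> b /msupp_minor [s ->] i.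
rewrite (big_morph (rowdeg i) (rowdegD i) (rowdeg0 i)).
under eq_bigr => a _ do rewrite rowdegU.
by rewrite -big_mkcond /= big_pred1_eq.
Qed.

Lemma row_homog_monomial (m : 'X_{1..'C(n, k)}) : row_homog (mdeg m) (to_minors 'X_[m]).
Proof.
rewrite /to_minors mmapX mdegE /mmap1.
apply: (big_ind2 (fun (g : {mpoly F[k * n]}) d => row_homog d g)).
- exact: row_homog1.
- by move=> f d g e; apply: row_homogM.
move=> l _; elim: (m l) => [|d IH]; first exact: row_homog1.
by rewrite exprS -add1n; apply: row_homogM => //; apply: row_homog_minor.
Qed.

Lemma to_minorsE p : to_minors p = \sum_(m <- msupp p) p@_m *: to_minors 'X_[m].
Proof.
by apply: eq_bigr => m _; rewrite mul_mpolyC /to_minors mmapX.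
Qed.

(** The polynomial [p'] is the part of [p] of some degree [d]. A product of [d] minors has total
    degree [k * d], and [k > 0], so the other parts have no monomial of the degree of [a]. *)
Lemma to_minors_component p a : a \in msupp (to_minors p) ->
  exists d p', [/\ forall i : 'I_k, rowdeg i a = d, row_homog d (to_minors p') &
    forall b, mdeg b = mdeg a -> (to_minors p')@_b = (to_minors p)@_b].
Proof.
rewrite to_minorsE => /msupp_sum_le /flattenP [t] /mapP [m _ ->] /msuppZ_le ham.
pose d := mdeg m; have hd i : rowdeg i a = d := row_homog_monomial ham i.
pose q := \sum_(m' <- msupp p | mdeg m' == d) p@_m' *: 'X_[m'].
have Eq : to_minors q = \sum_(m' <- msupp p | mdeg m' == d) p@_m' *: to_minors 'X_[m'].
  rewrite /q rmorph_sum /=; apply: eq_bigr => m' _.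
  by rewrite -mul_mpolyC rmorphM /= [to_minors _%:MP]mmapC mul_mpolyC.
exists d, q; split=> //.
  move=> b; rewrite Eq => /msupp_sum_le /flattenP [t'] /mapP [m'].
  by rewrite mem_filter => /andP[/eqP <- _] -> /msuppZ_le /row_homog_monomial.
move=> b hb; rewrite Eq [in RHS](bigID (fun m' => mdeg m' == d)) /= mcoeffD.
rewrite [X in _ + X](_ : _ = 0) ?addr0 // raddf_sum /= big1 // => m' nm'.
rewrite mcoeffZ [_@_b]memN_msupp_eq0 ?mulr0 //; apply: contra nm' => hbm.
move: hb; rewrite !mdeg_rowdeg.
under eq_bigr => i _ do rewrite (row_homog_monomial hbm).
under [RHS]eq_bigr => i _ do rewrite hd.
by rewrite !sum_nat_const card_ord => /eqP; rewrite eqn_pmul2l.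
Qed.

(* Columns from right to left, each from top to bottom, so that the diagonal
   monomial leads every minor. *)
Definition cpos (q : 'I_(k * n)) : nat :=
  mxvec (\matrix_(i < k, j < n) ((n.-1 - j) * k + i)%N) 0 q.

Lemma cposE i j : cpos (mxvec_index i j) = ((n.-1 - j) * k + i)%N.
Proof. by rewrite /cpos mxvecE mxE. Qed.

Lemma cpos_inj : injective cpos.
Proof.
move=> q q'; case/mxvec_indexP: q => i j; case/mxvec_indexP: q' => i' j'.
rewrite !cposE => e.
have ei : i = i' :> nat.
  by have := congr1 (modn^~ k) e; rewrite !modnMDl !modn_small.
have ej : (n.-1 - j = n.-1 - j')%N.
  by move/eqP: e; rewrite ei eqn_add2r eqn_pmul2r // => /eqP.
congr mxvec_index; apply: val_inj => //=.
by have := ltn_ord j; have := ltn_ord j'; lia.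
Qed.

Lemma cpos_lt q : (cpos q < k * n)%N.
Proof.
case/mxvec_indexP: q => i j; rewrite cposE.
have := ltn_ord i; have := ltn_ord j; nia.
Qed.

Lemma cposS (i i' : 'I_k) j : i' = i.+1 :> nat ->
  cpos (mxvec_index i' j) = (cpos (mxvec_index i j)).+1.
Proof. by rewrite !cposE => ->; rewrite addnS. Qed.

(** The leading exponent also leads the homogeneous component that contains it, and [stage_bound]
    applies to that component. *)
Lemma lead_interlacing p a : mlead (rlmap cpos (to_minors p)) = rlkey cpos a ->
  a \in msupp (to_minors p) ->
  (exists d, forall i : 'I_k, rowdeg i a = d) /\
  forall (i i' : 'I_k) (m : 'I_n), i' = i.+1 :> nat ->
     (\sum_(j < n | (j <= m)%N) a (mxvec_index i' j) <=
      \sum_(j < n | (j < m)%N) a (mxvec_index i j))%N.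
Proof.
move=> la ha; have [d [p' [hd hp' hc]]] := to_minors_component ha.
split; first by exists d.
have st : stage cpos 0 (to_minors p') a.
  split; first exact: row_invariant_to_minors.
    by rewrite mcoeff_msupp hc // -mcoeff_msupp.
  move=> b hb; have dba : mdeg b = mdeg a.
    by rewrite !mdeg_rowdeg; apply: eq_bigr => i _; rewrite (hp' b hb) hd.
  split=> // [i|v]; first by rewrite (hp' b hb) hd.
  apply: (rlmap_lead_min cpos_inj cpos_lt la _ dba).
  by rewrite mcoeff_msupp -hc // -mcoeff_msupp.
move=> i i' m hi; have := stage_bound cpos_inj cposS m st hi.
(* In rows [i] and [i + 1], the positions from that of [(i, m)] on are the columns up to [m].
   Cancelling [a] at [(i, m)] then makes the range of columns in row [i] strict. *)
rewrite (eq_bigl (fun j : 'I_n => (j <= m)%N)); last first.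
  move=> j; rewrite !cposE hi; have := ltn_ord i'; rewrite hi.
  by have := ltn_ord j; have := ltn_ord m; nia.
rewrite [X in (_ <= X)%N -> _](eq_bigl (fun j : 'I_n => (j <= m)%N)); last first.
  by move=> j; rewrite !cposE; have := ltn_ord j; have := ltn_ord m; nia.
rewrite [X in (_ <= X)%N -> _](bigD1 m) //= addnC leq_add2l => h.
apply: leq_trans h _; rewrite leq_eqVlt; apply/orP; left; apply/eqP.
by apply: eq_bigl => j; rewrite ltn_neqAle andbC.
Qed.

Lemma lead_to_minors p : to_minors p != 0 ->
  exists2 a, mlead (rlmap cpos (to_minors p)) = rlkey cpos a & mnm_rv a \in in_Gamma k n.
Proof.
move/(rlmap_lead cpos_inj cpos_lt) => [a ha la]; exists a => //.
by have [[d hd] hi] := lead_interlacing la ha; apply: interlacing_in_Gamma hd hi.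
Qed.

Lemma minor_neq0 l : minor l != 0.
Proof.
pose J := tnth (minor_cols l).
have Jinj : injective J.
  move=> i i' e; apply: val_inj; case: (ltngtP i i') => // /(minor_cols_lt l);
  by rewrite -/J e ltnn.
apply/eqP => m0.
(* At this point the chosen columns form the identity matrix. *)
pose M : 'M[F]_(k, n) := \matrix_(i, j) (j == J i)%:R.
have := @eval_to_minors _ idfun M 'X_l.
have -> : to_minors 'X_l = 0 by rewrite /to_minors mmapX mmap1U.
rewrite /eval_mx raddf0 mmapX mmap1U -/J.
have -> : colsub J M = 1%:M.
  by apply/matrixP => i j; rewrite !mxE (inj_eq Jinj) eq_sym.
by rewrite det1 => /esym /eqP; rewrite oner_eq0.
Qed.

(** The leading exponent comes from some permutation [s]; interlacing forces [s] to increase, so [s]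
    is the identity and the monomial is diagonal. *)
Lemma lead_minor l : mlead (rlmap cpos (minor l)) = rlkey cpos (diag_mnm l).
Proof.
have [a ha la] := rlmap_lead cpos_inj cpos_lt (minor_neq0 l).
rewrite la; congr rlkey.
have eX : to_minors 'X_l = minor l by rewrite /to_minors mmapX mmap1U.
have [_ hi] : _ /\ _ := @lead_interlacing 'X_l a ltac:(by rewrite eX) ltac:(by rewrite eX).
have [s es] := msupp_minor ha.
set J := tnth (minor_cols l) in es.
have aE i j : a (mxvec_index i j) = (j == J (s i)).
  rewrite es mnm_sumE (bigD1 i) //= mnm1E eq_mxvec_index eqxx eq_sym big1 ?addn0 //.
  by move=> i1 ni; rewrite mnm1E eq_mxvec_index (negbTE ni).
have s1 : forall i, s i = i.
  apply: perm_incr_id => i i' hii.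
  have : (0 < \sum_(j < n | (j < J (s i'))%N) a (mxvec_index i j))%N.
    apply: leq_trans (hi i i' (J (s i')) hii).
    by rewrite (bigD1 (J (s i'))) //= aE eqxx.
  rewrite lt0n sum_nat_eq0 => /forallPn [j]; rewrite negb_imply aE => /andP[hj].
  case: (eqVneq j (J (s i))) hj => // -> hj _; rewrite ltnNge leq_eqVlt; apply/negP => /orP[/eqP e|].
    by rewrite (val_inj e) ltnn in hj.
  by move/(minor_cols_lt l); rewrite -/J; lia.
apply/mnmP => q; case/mxvec_indexP: q => i j.
by rewrite diag_mnmE aE s1.
Qed.

Lemma lead_minors_monomial (m : 'X_{1..'C(n, k)}) :
  to_minors 'X_[m] != 0 /\ mlead (rlmap cpos (to_minors 'X_[m])) =
    rlkey cpos (\sum_l diag_mnm l *+ m l)%MM.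
Proof.
rewrite /to_minors mmapX /mmap1.
pose P (g : {mpoly F[k * n]}) b := g != 0 /\ mlead (rlmap cpos g) = rlkey cpos b.
have P1 : P 1 0%MM by rewrite /P oner_neq0 rmorph1 mlead1 rlkey0.
have PM f a g b : P f a -> P g b -> P (f * g) (a + b)%MM.
  move=> [f0 lf] [g0 lg]; split; first by rewrite mulf_neq0.
  by rewrite rmorphM mleadM ?(rlmap_eq0 cpos_inj cpos_lt) // lf lg rlkeyD.
apply: (big_ind2 P) => // l _.
elim: (m l) => [|d IH]; first by rewrite mulm0n.
by rewrite exprS mulmS; apply: PM => //; split; [exact: minor_neq0 | exact: lead_minor].
Qed.

End GenericMinors.

(** * Order functions from leading monomials *)

(** The value of [f] is the leading exponent of [theta f], read in [G] through [key]; injectivity of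
    [key] makes it unique. *)
Lemma order_function_mlead (F : finFieldType) (R : comAlgType F) (G : eqType)
    (add : G -> G -> G) m (key : G -> 'X_{1..m}) (theta : R -> {mpoly F[m]}) :
  injective key -> {morph key : a b / add a b >-> (a + b)%MM} ->
  (forall f, theta f = 0 -> f = 0) ->
  {morph theta : f g / f + g} -> {morph theta : f g / f * g} ->
  (forall c f, theta (c *: f) = c *: theta f) ->
  (forall f, f != 0 -> exists x, mlead (theta f) = key x) ->
  (forall x, exists2 f, f != 0 & mlead (theta f) = key x) ->
  exists rho : R -> option G, order_function add (fun a b => (key a < key b)%O) rho.
Proof.
move=> keyI keyD theta_inj thetaD thetaM thetaZ lead_key key_lead.
pose lt a b := (key a < key b)%O.
have theta0 : theta 0 = 0 by have := thetaZ 0 0; rewrite !scale0r.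
have theta_eq0 f : (theta f == 0) = (f == 0).
  by apply/eqP/eqP => [/theta_inj //|->].
pose spec (f : R) (o : option G) :=
  if o is Some x then f != 0 /\ mlead (theta f) = key x else f = 0.
have [rho rhoP] : {rho : R -> option G & forall f, spec f (rho f)}.
  apply: choice => f; have [->|nz] := eqVneq f 0; first by exists None.
  by have [x hx] := lead_key f nz; exists (Some x).
rewrite /spec in rhoP.
have rhoE f x : f != 0 -> mlead (theta f) = key x -> rho f = Some x.
  move=> nz hx; have := rhoP f; case: (rho f) => [y [_ hy]|f0].
    by congr Some; apply: keyI; rewrite -hx.
  by rewrite f0 eqxx in nz.
have rho0 : rho 0 = None.
  by have := rhoP 0; case: (rho 0) => // x []; rewrite eqxx.
have rho_lt f x : (f != 0 -> (mlead (theta f) < key x)%O) -> ninf_lt lt (rho f) (Some x).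
  by move=> h; have := rhoP f; case: (rho f) => // y [nz hy]; rewrite /= /lt -hy h.
have rho_le f x : (f != 0 -> (mlead (theta f) <= key x)%O) -> ninf_le lt (rho f) (Some x).
  move=> h; rewrite /ninf_le; have := rhoP f; case: (rho f) => // y [nz hy].
  have := h nz; rewrite hy le_eqVlt => /orP[/eqP /keyI ->|yx]; first by rewrite eqxx.
  by rewrite /= /lt yx orbT.
exists rho; split.
- case=> [x|]; last by exists 0.
  by have [f nz hf] := key_lead x; exists f; apply: rhoE.
- move=> f; split=> [e|->//]; by have := rhoP f; rewrite e.
- move=> c f nzc; have := rhoP f; case: (rho f) => [x [nz hx]|->]; last by rewrite scaler0.
  by apply: rhoE; rewrite ?thetaZ ?mleadZ // scaler_eq0 negb_or nzc.
- move=> f g; have := rhoP f; have := rhoP g.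
  case: (rho f) => [x|] hg hf; last first.
    rewrite hf add0r; have := rhoP g; case: (rho g) => [y|] _; by rewrite /ninf_le eqxx.
  case eg: (rho g) hg => [y|] hg; last first.
    by rewrite hg addr0 (rhoE _ _ hf.1 hf.2) /ninf_le eqxx.
  have le_max : ninf_max lt (Some x) (Some y) = Some (if lt x y then y else x).
    by rewrite /ninf_max /=; case: ifP.
  rewrite le_max; apply: rho_le => _; rewrite thetaD.
  apply: le_trans (mleadD_le _ _) _; rewrite hf.2 hg.2 leUx /lt.
  by case: ltP => [/ltW ->|->]; rewrite lexx ?andbT.
- move=> f g e; have := rhoP g; have := rhoP f; rewrite -e.
  case: (rho f) => // x [nzf hf] [nzg hg] _.
  pose a := (theta f)@_(key x); pose b := (theta g)@_(key x).
  have nza : a != 0 by rewrite /a -hf mleadc_eq0 theta_eq0.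
  have nzb : b != 0 by rewrite /b -hg mleadc_eq0 theta_eq0.
  (* The quotient of the leading coefficients cancels the common leading term. *)
  exists (a / b); first by rewrite mulf_neq0 ?invr_neq0.
  apply: rho_lt; rewrite -theta_eq0 -scaleN1r !(thetaD, thetaZ) => nz.
  rewrite lt_neqAle; apply/andP; split.
    apply: contraNneq nz => e'; rewrite -mleadc_eq0 e' mcoeffD !mcoeffZ -/a -/b.
    by rewrite mulN1r divfK // subrr.
  apply: le_trans (mleadD_le _ _) _; rewrite leUx hf lexx /= -hg.
  by apply: le_trans (mleadZ_le _ _) (mleadZ_le _ _).
move=> f g; have := rhoP f; case: (rho f) => [x [nzf hf]|->]; last by rewrite mul0r rho0.
have := rhoP g; case: (rho g) => [y [nzg hg]|->]; last by rewrite mulr0 rho0.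
have nzfg : f * g != 0 by rewrite -theta_eq0 thetaM mulf_neq0 ?theta_eq0.
by apply: rhoE; rewrite // thetaM keyD mleadM ?theta_eq0 // hf hg.
Qed.

(** * Polynomials vanishing at all points over a closed field *)

Lemma closed_field_infinite (K : closedFieldType) (s : seq K) : exists x, x \notin s.
Proof.
(* No element of [s] is a root of [p]; the factor ['X] keeps [p] nonconstant when [s] is empty. *)
pose p := 'X * \prod_(a <- s) ('X - a%:P) + 1 : {poly K}.
have sz : size ('X * \prod_(a <- s) ('X - a%:P) : {poly K}) = (size s).+2.
  rewrite mulrC size_mulX ?size_prod_XsubC //.
  by rewrite monic_neq0 // monic_prod_XsubC.
have /closed_rootP [x] : size p != 1%N.
  by rewrite size_polyDl ?sz // size_poly1.
move=> px; exists x; apply: contraTN px => xs.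
suff : root ('X * \prod_(a <- s) ('X - a%:P)) x.
  by rewrite /root /p hornerD hornerC => /eqP ->; rewrite add0r oner_eq0.
by rewrite rootM root_prod_XsubC xs orbT.
Qed.

Lemma closed_field_uniq_seq (K : closedFieldType) m :
  exists2 s : seq K, uniq s & size s = m.
Proof.
elim: m => [|m [s us <-]]; first by exists [::].
by have [x xs] := closed_field_infinite s; exists (x :: s); rewrite //= xs us.
Qed.

(** A nonzero polynomial stays nonzero while its variables are replaced by constants one at a time:
    in the next variable it has finitely many roots, whereas [K] is infinite. *)
Lemma mpoly_eval_eq0 (F : fieldType) (K : closedFieldType) (iota : {rmorphism F -> K})
    N (p : {mpoly F[N]}) : (forall w : 'I_N -> K, mmap iota w p = 0) -> p = 0.
Proof.
move=> h; apply/eqP/negPn/negP => nz.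
pose A := {mpoly K[N]}.
have [w hw] : exists w : 'I_N -> K,
    mmap (@mpolyC N K \o iota) (fun q => (w q)%:MP) p != 0.
  pose P c := exists w : 'I_N -> K, mmap (@mpolyC N K \o iota)
    (fun q => if (q < c)%N then (w q)%:MP else 'X_q) p != 0.
  suff [w hw] : P N.
    exists w; suff <- : mmap (@mpolyC N K \o iota)
      (fun q : 'I_N => if (q < N)%N then (w q)%:MP else 'X_q) p =
      mmap (@mpolyC N K \o iota) (fun q => (w q)%:MP) p by [].
    by apply: eq_bigr => b _; congr (_ * _); apply: mmap1_eq => q; rewrite ltn_ord.
  elim: {-2}N (leqnn N) => [|c IH] hc.
    exists (fun=> 0); apply: contra nz => /eqP e; apply/eqP/mpolyP => b.
    have := congr1 (mcoeff b) e; rewrite -/(map_mpoly iota p) mcoeff_map_mpoly.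
    by rewrite !mcoeff0 => /eqP; rewrite fmorph_eq0 => /eqP.
  have [w hw] := IH (ltnW hc).
  pose q0 := Ordinal hc.
  pose Q : {poly A} := mmap (polyC \o (@mpolyC N K \o iota))
    (fun q => if q == q0 then 'X else (if (q < c)%N then (w q)%:MP else 'X_q : A)%:P) p.
  have QE (x : A) : Q.[x] = mmap (@mpolyC N K \o iota)
      (fun q => if q == q0 then x else if (q < c)%N then (w q)%:MP else 'X_q) p.
    rewrite /Q /mmap horner_sum; apply: eq_bigr => b _; rewrite hornerM hornerC.
    congr (_ * _); rewrite /mmap1 horner_prod; apply: eq_bigr => q _.
    by rewrite horner_exp; case: ifP => _; rewrite ?hornerX ?hornerC.
  have Qnz : Q != 0.
    (* Evaluating [Q] at the variable [q0] itself gives back the current polynomial. *)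
    apply: contra hw => /eqP Q0; have := QE 'X_q0; rewrite Q0 horner0 => e.
    rewrite [X in X == _](_ : _ = 0) // [RHS]e; apply: eq_bigr => b _.
    congr (_ * _); apply: mmap1_eq => q.
    by case: eqP => // ->; rewrite ltnn.
  have [x hx] : exists x : K, Q.[x%:MP] != 0.
    have [s us szs] := closed_field_uniq_seq K (size Q).
    suff : ~~ all (root Q) [seq (@mpolyC N K) x | x <- s].
      by rewrite all_map => /allPn [x _ hx]; exists x.
    apply/negP => rs; have := max_poly_roots Qnz rs.
    by rewrite (map_inj_uniq (can_inj (@mpolyCK N K))) us size_map szs ltnn => /(_ isT).
  exists (fun q => if q == q0 then x else w q).
  move: hx; rewrite QE; apply: contra => /eqP e; apply/eqP; rewrite -[RHS]e.
  apply: eq_bigr => b _; congr (_ * _); apply: mmap1_eq => q.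
  rewrite ltnS [(q <= c)%N]leq_eqVlt; case: (eqVneq q q0) => [->|nq]; first by rewrite /= eqxx.
  suff -> : (val q == c) = false by [].
  by apply: contraNF nq => /eqP e'; apply/eqP/val_inj.
suff e : mmap (@mpolyC N K \o iota) (fun q => (w q)%:MP) p = (mmap iota w p)%:MP.
  by move: hw; rewrite e h mpolyC0 eqxx.
rewrite /mmap raddf_sum; apply: eq_bigr => b _; rewrite /= mpolyCM; congr (_ * _).
by rewrite /mmap1 rmorph_prod; apply: eq_bigr => q _; rewrite rmorphXn.
Qed.

(** * The coordinate ring *)

Lemma det_colsub_scalerow (A : comNzRingType) k n (f : 'I_k -> 'I_n) (i : 'I_k) z
    (M : 'M[A]_(k, n)) : \det (colsub f (scalerow i z M)) = z * \det (colsub f M).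
Proof.
rewrite (@determinant_multilinear _ _ _ (colsub f M) (colsub f M) i z 0).
- by rewrite mul0r addr0.
- by apply/rowP => b; rewrite !mxE eqxx mul0r addr0.
- by apply/matrixP => a b; rewrite !mxE eq_sym (negbTE (neq_lift _ _)) mul1r.
by apply/matrixP => a b; rewrite !mxE eq_sym (negbTE (neq_lift _ _)) mul1r.
Qed.

(** As [k > 0], the scalar is absorbed into the first row and the vertex comes from the zero matrix.
    Conversely, a nonzero minor makes the rows of [M] a basis of their span. *)
Lemma affine_coneP (K : fieldType) k n (v : 'rV[K]_'C(n, k)) : (0 < k)%N ->
  affine_cone v <-> exists M : 'M[K]_(k, n), v = plucker M.
Proof.
move=> k_gt0; split=> [[->|[U [b [c [_ _ _ ->]]]]]|[M ->]].
- exists 0; apply/rowP => l; rewrite !mxE [X in \det X](_ : _ = 0).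
    by case: (k) k_gt0 => // k' _; rewrite det0.
  by apply/matrixP => i j; rewrite !mxE.
- exists (scalerow (Ordinal k_gt0) c (\matrix_(i < k) tnth b i)).
  by apply/rowP => l; rewrite !mxE det_colsub_scalerow.
have [->|nz] := eqVneq (plucker M) 0; [by left | right].
pose b := [tuple row i M | i < k].
have bM : \matrix_(i < k) tnth b i = M.
  by apply/row_matrixP => i; rewrite rowK tnth_mktuple.
have fb : free b.
  apply/freeP => a; rewrite (eq_bigr (fun i => a i *: row i M)); last first.
    by move=> i _; rewrite nth_mktuple.
  have [l nzl] : exists l, plucker M 0 l != 0.
    apply/existsP; apply: contraR nz => /existsPn h; apply/eqP/rowP => l.
    by rewrite [RHS]mxE; apply/eqP; have := h l; rewrite negbK.
  move=> e; set f := tnth (minor_cols l).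
  have uM : colsub f M \in unitmx by rewrite unitmxE unitfE; rewrite mxE in nzl.
  have rM : (\row_i a i) *m M = 0.
    by rewrite mulmx_sum_row -[RHS]e; apply: eq_bigr => i _; rewrite mxE.
  have : (\row_i a i) *m colsub f M = 0.
    apply/rowP => j; have := congr1 (fun u : 'rV_n => u 0 (f j)) rM.
    by rewrite !mxE => h; rewrite -[RHS]h; apply: eq_bigr => i _; rewrite !mxE.
  move/(congr1 (mulmxr (invmx (colsub f M)))); rewrite /= mulmxK // mul0mx.
  by move=> /rowP h i; have := h i; rewrite !mxE.
exists <<b>>%VS, b, 1; split; rewrite ?oner_eq0 ?scale1r ?bM //.
  by rewrite (eqnP fb) size_tuple.
by rewrite basisEfree fb subvv size_tuple (eqnP fb) size_tuple /=.
Qed.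

Section CoordRing.
Variables (F : finFieldType) (k n : nat).
Hypothesis k_gt0 : (0 < k)%N.

(** The cone consists of the Plücker vectors of all matrices over the closure, and a polynomial in
    the entries that vanishes at all of these is zero. *)
Lemma plucker_idealE (p : {mpoly F['C(n, k)]}) :
  (p \in plucker_ideal F k n) = (to_minors p == 0).
Proof.
have evalE (M : 'M[alg_closure F]_(k, n)) :
    (map_mpoly (to_closure F) p).@[plucker M 0] = eval_mx (to_closure F) M (to_minors p).
  rewrite eval_to_minors [in LHS]/map_mpoly {1}/mmap raddf_sum; apply: eq_bigr => m _.
  rewrite /= mevalM mevalC mmap1_id mevalX; congr (_ * _).
  by apply: eq_bigr => l _; rewrite mxE.
apply/plucker_idealP/eqP => [h|p0 v].
  apply: (mpoly_eval_eq0 (iota := to_closure F)) => w.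
  have := h _ ((affine_coneP _ k_gt0).2 (ex_intro _ (vec_mx (\row_q w q)) erefl)).
  rewrite evalE /eval_mx vec_mxK => e; rewrite -[RHS]e.
  by apply: eq_bigr => b _; congr (_ * _); apply: mmap1_eq => q; rewrite mxE.
by move=> /(affine_coneP _ k_gt0) [M ->]; rewrite evalE p0 /eval_mx raddf0.
Qed.

Local Open Scope quotient_scope.
Local Notation pi p := (\pi_{ideal_quot (plucker_ideal F k n)} p : coord_ring F k n).

Lemma to_minors_repr p : to_minors (repr (pi p)) = to_minors p.
Proof.
apply/eqP; rewrite -subr_eq0 -rmorphB -plucker_idealE.
by rewrite Quotient.idealrBE reprK.
Qed.

(** The embedding of the coordinate ring onto the algebra generated by the maximal minors. *)
Definition coord_minors (f : coord_ring F k n) : {mpoly F[k * n]} := to_minors (repr f).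

Lemma coord_minors_pi p : coord_minors (pi p) = to_minors p.
Proof. exact: to_minors_repr. Qed.

Lemma coord_minorsD : {morph coord_minors : f g / f + g}.
Proof.
move=> f g; rewrite -[f]reprK -[g]reprK -[X in coord_minors X]rmorphD.
by rewrite !coord_minors_pi rmorphD.
Qed.

Lemma coord_minorsM : {morph coord_minors : f g / f * g}.
Proof.
move=> f g; rewrite -[f]reprK -[g]reprK -[X in coord_minors X]rmorphM.
by rewrite !coord_minors_pi rmorphM.
Qed.

Lemma coord_minorsZ c f : coord_minors (c *: f) = c *: coord_minors f.
Proof.
rewrite [c *: f]/(coord_scale c f) [LHS]coord_minorsM coord_minors_pi.
by rewrite [to_minors _%:MP]mmapC mul_mpolyC.
Qed.

Lemma coord_minors_eq0 f : coord_minors f = 0 -> f = 0.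
Proof.
move=> e; rewrite -[f]reprK -[RHS](rmorph0 (\pi_{ideal_quot (plucker_ideal F k n)})).
by apply/eqP; rewrite -Quotient.idealrBE subr0 plucker_idealE; apply/eqP.
Qed.

End CoordRing.

(** * The monomial order and the order domain *)

Definition rl_lt k n (u v : 'rV[nat]_(k * n)) : bool :=
  (rlkey (@cpos k n) (rv_mnm u) < rlkey (@cpos k n) (rv_mnm v))%O.

Lemma rl_lt_monomial_order k n : (0 < k)%N -> monomial_order (@rl_lt k n).
Proof.
move=> hk; split.
- exact: addrA.
- exact: addrC.
- by move=> u; apply: ltxx.
- by move=> v u w; apply: lt_trans.
- move=> u v; rewrite /rl_lt.
  have -> : (u == v) = (rlkey (@cpos k n) (rv_mnm u) == rlkey (@cpos k n) (rv_mnm v)).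
    by rewrite (inj_eq (rlkey_inj (cpos_inj hk) (@cpos_lt k n hk))) (inj_eq (can_inj (@rv_mnmK k n))).
  by case: ltgtP.
- by move=> u v w; rewrite /rl_lt !rv_mnmD !rlkeyD ltmc_add2l.
exact: (wf_inverse_image _ _ _ _ (@ltom_wf _)).
Qed.

Theorem corollary2 (F : finFieldType) (k n : nat) (hk : (1 <= k)%N) (hkn : (k <= n)%N) :
  exists mlt : rel 'rV[nat]_(k * n),
    monomial_order mlt /\
    exists rho : coord_ring F k n -> option (Gamma k n),
      order_domain (fun a b : Gamma k n => a + b)
        (fun a b : Gamma k n => mlt (val a) (val b)) rho.
Proof.
exists (@rl_lt k n); have mo := @rl_lt_monomial_order k n hk; split=> //.
pose key (x : Gamma k n) := rlkey (@cpos k n) (rv_mnm (val x)).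
have keyI : injective key.
  by move=> x y /(rlkey_inj (cpos_inj hk) (@cpos_lt k n hk)) /(can_inj (@rv_mnmK k n)) /val_inj.
pose theta (f : coord_ring F k n) := rlmap (@cpos k n) (coord_minors f).
have theta_eq0 f : theta f = 0 -> f = 0.
  move/eqP; rewrite (rlmap_eq0 (cpos_inj hk) (@cpos_lt k n hk)) => /eqP.
  exact: coord_minors_eq0.
have [] // := @order_function_mlead F (coord_ring F k n) (Gamma k n)
  (fun a b => a + b) _ key theta keyI.
- by move=> x y; rewrite /key -rlkeyD -rv_mnmD.
- by move=> f g; rewrite /theta coord_minorsD // rmorphD.
- by move=> f g; rewrite /theta coord_minorsM // rmorphM.
- move=> c f; rewrite /theta coord_minorsZ // -mul_mpolyC rmorphM /=.
  by rewrite [rlmap _ _%:MP]mmapC mul_mpolyC.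
- move=> f nz; have nzm : to_minors (repr f) != 0.
    by apply: contraNneq nz => e; apply/eqP; apply: coord_minors_eq0.
  have [a la ga] := lead_to_minors hk nzm.
  by exists (MkGamma ga); rewrite /key /= mnm_rvK.
- move=> [u ux]; have /asboolP [a ea] := ux.
  (* The coefficients of [u] on the generators of [Gamma] are the exponents of a monomial in the
     minors with value [u]. *)
  pose m : 'X_{1..'C(n, k)} := [multinom a 0%R l | l < 'C(n, k)].
  have [nz lm] := lead_minors_monomial F hk m.
  exists (\pi_{ideal_quot (plucker_ideal F k n)} 'X_[m])%qT.
    apply: contra nz => /eqP e; rewrite -(coord_minors_pi hk) e.
    by rewrite -[X in coord_minors X](rmorph0 (\pi_{ideal_quot (plucker_ideal F k n)})%qT)
      coord_minors_pi // rmorph0.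
  rewrite /theta coord_minors_pi // lm /key /=; congr rlkey.
  apply/mnmP => q; rewrite mnm_sumE mnmE ea mxE.
  by apply: eq_bigr => l _; rewrite mulmnE mnmE mxE /m mnmE mulnC.
move=> rho of_rho; exists rho; split; last exact: of_rho.
case: mo => _ _ irr tr tot addr wf; split.
- exact: addrA.
- exact: addrC.
- by move=> x; apply: irr.
- by move=> y x z; apply: tr.
- by move=> x y; rewrite -(inj_eq val_inj); apply: tot.
- by move=> x y z; apply: addr.
exact: (wf_inverse_image _ _ _ _ wf).
Qed.
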